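(* The graph $\mathcal{A}_1$ is neither $(1,1,3,3)$-packing colorable nor $(1,2,2,3)$-packing colorable. Moreover, there are infinitely many (pairwise non-isomorphic) connected claw-free subcubic graphs that contain $\mathcal{A}_1$ as a subgraph.
   Context: All graphs are finite and simple. A graph is subcubic if its maximum degree is at most $3$, and claw-free if it has no induced $K_{1,3}$. For a non-decreasing sequence $S=(a_1,\ldots,a_r)$ of positive integers, an $S$-packing coloring of a graph $G$ is a partition of $V(G)$ into (possibly empty) sets $A_1,\ldots,A_r$ such that, for every $i$, any two distinct vertices in $A_i$ are at distance greater than $a_i$ in $G$; $G$ is $S$-packing colorable if such a coloring exists. The graph $\mathcal{A}_1$ has vertex set $\{1,\ldots,9\}$ and edges $12,23,34,45,56,67,78,89,91$ (a $9$-cycle) together with $\{9,2\},\{3,5\},\{6,8\}$. *)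

(* Defs.v *)
From mathcomp Require Import all_boot.

Set Implicit Arguments.
Unset Strict Implicit.
Unset Printing Implicit Defensive.

Record sgraph := SGraph {
  vertex :> finType;
  adj : rel vertex;
  adj_sym : symmetric adj;
  adj_irrefl : irreflexive adj }.

Section Graph.
Variable G : sgraph.
Implicit Types (x y : G) (S : seq nat).

Definition degree x : nat := #|[set y | adj x y]|.
Definition max_degree : nat := \max_(x : G) degree x.
Definition subcubic : Prop := max_degree <= 3.

Definition connected : Prop :=
  0 < #|G| /\ forall x y, connect (@adj G) x y.

Definition walk (n : nat) x y : bool :=
  [exists p : n.-tuple G, path (@adj G) x p && (last x p == y)].

Lemma connect_walk x y : connect (@adj G) x y -> exists n, walk n x y.
Proof.
case/connectP=> p xp ->; exists (size p).
by apply/existsP; exists (in_tuple p); rewrite xp eqxx.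
Qed.

(* [None] is the infinite distance between distinct components. *)
Definition dist x y : option nat :=
  match @idP (connect (@adj G) x y) with
  | ReflectT xy => Some (ex_minn (connect_walk xy))
  | ReflectF _ => None
  end.

Definition dist_gt x y (a : nat) : Prop :=
  if dist x y is Some d then a < d else True.

(* Entry [nth 0 S i] is a_(i+1). Monotonicity and positivity of S are not
   needed for the definition to make sense, so they are not imposed here. *)
Definition packing_coloring S (A : 'I_(size S) -> {set G}) : Prop :=
  [/\ forall x, exists i, x \in A i,
      forall i j, i != j -> [disjoint A i & A j]
    & forall i x y, x \in A i -> y \in A i -> x != y ->
        dist_gt x y (nth 0 S i)].

Definition packing_colorable S : Prop :=
  exists A : 'I_(size S) -> {set G}, @packing_coloring S A.

End Graph.

Definition contains_subgraph (G H : sgraph) : Prop :=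
  exists2 f : H -> G, injective f & forall x y, adj x y -> adj (f x) (f y).

Definition contains_induced (G H : sgraph) : Prop :=
  exists2 f : H -> G, injective f & forall x y, adj (f x) (f y) = adj x y.

Definition isomorphic (G H : sgraph) : Prop :=
  exists2 f : G -> H, bijective f & forall x y, adj (f x) (f y) = adj x y.

Definition claw_adj : rel 'I_4 := fun x y => (x == ord0) != (y == ord0).

Lemma claw_sym : symmetric claw_adj.
Proof. by move=> x y; rewrite /claw_adj eq_sym. Qed.

Lemma claw_irrefl : irreflexive claw_adj.
Proof. by move=> x; rewrite /claw_adj eqxx. Qed.

Definition claw : sgraph := SGraph claw_sym claw_irrefl.

Definition claw_free (G : sgraph) : Prop := ~ contains_induced G claw.

Definition A1_edges : seq (nat * nat) :=
  [:: (1, 2); (2, 3); (3, 4); (4, 5); (5, 6); (6, 7); (7, 8); (8, 9); (9, 1);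
      (9, 2); (3, 5); (6, 8)].

(* The ordinal i : 'I_9 stands for the vertex labelled i + 1. *)
Definition A1_adj : rel 'I_9 := fun i j =>
  ((i.+1, j.+1) \in A1_edges) || ((j.+1, i.+1) \in A1_edges).

Lemma A1_sym : symmetric A1_adj.
Proof. by move=> i j; rewrite /A1_adj orbC. Qed.

Lemma A1_irrefl : irreflexive A1_adj.
Proof. by case=> m lt_m9; do 9! [case: m lt_m9 => [|m] lt_m9 //]. Qed.

Definition A1 : sgraph := SGraph A1_sym A1_irrefl.

(* Main.v *)
Require Import Defs.
From mathcomp Require Import all_boot.

(** A1 is a ring of three triangles, any two of which are joined by an edge.
    Vertices in two linked triangles are at distance at most 3, so a colour
    class whose points are more than 3 apart meets at most one of the three
    triangles ([far_colour_linked]); and every triangle uses three colours.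

    For (1,1,3,3), each of the last two colours meets at most one triangle, so
    some triangle is left with the first two colours only, which is too few.

    For (1,2,2,3), the last colour meets at most one triangle, so two linked
    triangles T and T' both use exactly the first three colours.  Let uv be
    the edge joining them.  Every vertex of T' is within distance 2 of u, so
    the colour of u, which occurs in T', cannot be one of the two middle
    colours; hence u has the first colour, and so has v by symmetry, although
    u and v are adjacent ([linked_triangles_last_colour]).

    The infinite family consists of A1 with a path of n vertices hung at the
    vertex 1, whose two neighbours in A1 are adjacent: this creates neither a
    claw nor a vertex of degree 4, and the orders of these graphs differ. *)

Set Implicit Arguments.
Unset Strict Implicit.
Unset Printing Implicit Defensive.

(** * Walks and packing colourings *)

Section Colouring.
Variable G : sgraph.
Implicit Types (x y z u v : G) (T : {set G}) (S : seq nat).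

Lemma walk_path x p : path (@adj G) x p -> walk (size p) x (last x p).
Proof. by move=> xp; apply/existsP; exists (in_tuple p); rewrite xp eqxx. Qed.

Lemma walk_cat m n x y z : walk m x y -> walk n y z -> walk (m + n) x z.
Proof.
case/existsP=> p /andP[xp /eqP py] /existsP[q /andP[yq /eqP qz]].
have := @walk_path x (p ++ q).
by rewrite cat_path last_cat py qz xp yq size_cat !size_tuple; apply.
Qed.

Lemma walk_adj x y : adj x y -> walk 1 x y.
Proof. by move=> xy; apply: (@walk_path x [:: y]); rewrite /= xy. Qed.

Lemma dist_gt_walk x y a n : dist_gt x y a -> walk n x y -> a < n.
Proof.
rewrite /dist_gt /dist; move: (@idP _).
(* Only the index of the reflect family may be abstracted: the proofs that it
   carries are about the connect relation itself. *)
move: {2}(connect _ _ _) => b [xy | not_xy] gt_a w_xy.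
  by case: ex_minnP gt_a => d _ /(_ n w_xy) le_dn /leq_trans; apply.
case: not_xy; case/existsP: w_xy => p /andP[xp /eqP <-].
by apply/connectP; exists p.
Qed.

(** A packing coloring seen as a map to the colours, with the distance
    condition expressed on walks, so that no distance has to be computed. *)
Definition packing_map S (c : G -> 'I_(size S)) : Prop :=
  forall x y n, c x = c y -> x != y -> walk n x y -> nth 0 S (c x) < n.

Lemma packing_mapP S : packing_colorable G S ->
  exists c : G -> 'I_(size S), packing_map c.
Proof.
case=> A [coverA _ farA].
exists (fun x => xchoose (coverA x)) => x y n cxy neq_xy.
apply: dist_gt_walk; apply: farA neq_xy; first exact: (xchooseP (coverA x)).
by rewrite cxy; apply: (xchooseP (coverA y)).
Qed.

(** * Linked triangles *)

Definition clique T : Prop := {in T &, forall x y, x != y -> adj x y}.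

Definition triangle T : Prop := clique T /\ #|T| = 3.

Definition linked T T' : Prop :=
  [disjoint T & T'] /\ exists u v, [/\ u \in T, v \in T' & adj u v].

Lemma linked_sym T T' : linked T T' -> linked T' T.
Proof.
case=> dis [u [v [uT vT' uv]]]; split; first by rewrite disjoint_sym.
by exists v, u; rewrite adj_sym.
Qed.

Lemma clique_walk T x y : clique T -> x \in T -> y \in T -> walk (x != y) x y.
Proof.
move=> clT xT yT; case: eqVneq => [-> | neq_xy] /=.
  exact: (@walk_path y [::]).
exact/walk_adj/clT.
Qed.

Section PackingMap.
Variables (S : seq nat) (c : G -> 'I_(size S)).
Hypotheses (c_packing : packing_map c) (S_gt0 : all (leq 1) S).

Lemma packing_map_clique T : clique T -> {in T &, injective c}.
Proof.
move=> clT x y xT yT cxy; apply/eqP; apply/negPn/negP=> neq_xy.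
have:= c_packing cxy neq_xy (walk_adj (clT _ _ xT yT neq_xy)).
by rewrite ltnNge; have/allP-> := S_gt0; rewrite ?mem_nth.
Qed.

Lemma triangle_colours T : triangle T -> #|c @: T| = 3.
Proof. by case=> clT <-; apply: card_in_imset; apply: packing_map_clique. Qed.

(** A vertex of T reaches u in at most one step, then v in one more, and v
    reaches any vertex of T' in at most one step. *)
Lemma linked_same_colour T T' u v x y : clique T -> clique T' ->
    [disjoint T & T'] -> u \in T -> v \in T' -> adj u v ->
    x \in T -> y \in T' -> c x = c y ->
  nth 0 S (c x) < (x != u) + 1 + (v != y).
Proof.
move=> clT clT' dis uT vT' uv xT yT' cxy; apply: (c_packing cxy).
  by apply: contraTneq yT' => <-; rewrite (disjointFr dis xT).
apply: walk_cat (clique_walk clT' vT' yT').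
exact: walk_cat (clique_walk clT xT uT) (walk_adj uv).
Qed.

Lemma far_colour_linked T T' (i : 'I_(size S)) :
    clique T -> clique T' -> linked T T' ->
  2 < nth 0 S i -> ~~ ((i \in c @: T) && (i \in c @: T')).
Proof.
move=> clT clT' [dis [u [v [uT vT' uv]]]] far_i.
apply/negP=> /andP[/imsetP[x xT ci] /imsetP[y yT' ciy]].
have := linked_same_colour clT clT' dis uT vT' uv xT yT'.
rewrite -ci -ciy => /(_ erefl)/(leq_ltn_trans far_i).
by case: (x != u); case: (v != y).
Qed.

End PackingMap.

Section Colour1223.
Let S := [:: 1; 2; 2; 3].
Variable c : G -> 'I_(size S).
Hypothesis c_packing : packing_map c.

(** The end u of the link is within distance 2 of the whole of T', where its
    colour occurs again; so that colour can only be the first one. *)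
Lemma link_end_colour T T' u v : triangle T -> triangle T' ->
    [disjoint T & T'] -> u \in T -> v \in T' -> adj u v ->
    ord_max \notin c @: T -> ord_max \notin c @: T' -> c u = ord0.
Proof.
move=> trT trT' dis uT vT' uv avoidT avoidT'.
have allT' : c @: T' = [set~ ord_max].
  apply/eqP; rewrite eqEcard (triangle_colours c_packing) // cardsC1 card_ord.
  rewrite leqnn andbT; apply/subsetP=> i iT'; rewrite !inE.
  by apply: contraNneq avoidT' => <-.
have: c u \in c @: T'.
  by rewrite allT' !inE; apply: contraNneq avoidT => <-; apply: imset_f.
case/imsetP=> y yT' cuy.
have := linked_same_colour c_packing trT.1 trT'.1 dis uT vT' uv uT yT' cuy.
rewrite eqxx; have: c u != ord_max.
  by apply: contraNneq avoidT => <-; apply: imset_f.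
case: (c u) => [[|[|[|[|//]]]]] lt_i //= _.
- by move=> _; apply: val_inj.
- by case: (v != y).
- by case: (v != y).
Qed.

Lemma linked_triangles_last_colour T T' : triangle T -> triangle T' ->
  linked T T' -> (ord_max \in c @: T) || (ord_max \in c @: T').
Proof.
move=> trT trT' [dis [u [v [uT vT' uv]]]].
rewrite -[_ || _]negbK negb_or; apply/negP=> /andP[avoidT avoidT'].
have cu := link_end_colour trT trT' dis uT vT' uv avoidT avoidT'.
have cv : c v = ord0.
  by apply: (link_end_colour trT' trT _ vT' uT) => //;
    rewrite 1?disjoint_sym 1?adj_sym.
have := c_packing (etrans cu (esym cv)) _ (walk_adj uv); rewrite cu.
by case: eqVneq uv => [->|_ _ /(_ isT)//]; rewrite adj_irrefl.
Qed.

End Colour1223.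

(** Both obstructions only use three pairwise linked triangles, so they hold
    in any graph in which A1 sits as a subgraph. *)
Section ThreeTriangles.
Variable T : 'I_3 -> {set G}.
Hypothesis triT : forall k, triangle (T k).
Hypothesis linkT : forall k l, k != l -> linked (T k) (T l).

Let k0 : 'I_3 := @Ordinal 3 0 isT.
Let k1 : 'I_3 := @Ordinal 3 1 isT.
Let k2 : 'I_3 := @Ordinal 3 2 isT.

Lemma three_triangles_not_1133 : ~ packing_colorable G [:: 1; 1; 3; 3].
Proof.
case/packing_mapP=> c c_pack.
pose i2 : 'I_4 := @Ordinal 4 2 isT; pose i3 : 'I_4 := @Ordinal 4 3 isT.
have meets k : (i2 \in c @: T k) || (i3 \in c @: T k).
  apply/norP=> -[no2 no3].
  suff/subset_leq_card: c @: T k \subset [set~ i2] :\ i3.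
    rewrite (triangle_colours c_pack) //.
    have -> : [set~ i2] :\ i3 = ~: [set i2; i3].
      by apply/setP=> i; rewrite !inE negb_or andbC.
    by rewrite cardsCs setCK cards2 card_ord.
  apply/subsetP=> i iT; rewrite !inE.
  by apply/andP; split; [apply: contraNneq no3 | apply: contraNneq no2] => <-.
have once (i : 'I_4) k l : 1 < i -> k != l ->
    ~~ ((i \in c @: T k) && (i \in c @: T l)).
  move=> i_gt1 /linkT lkl.
  apply: (far_colour_linked c_pack (triT k).1 (triT l).1 lkl).
  by case: i i_gt1 => [[|[|[|[|//]]]]].
move: (meets k0) (meets k1) (meets k2).
move: (once i2 k0 k1 isT isT) (once i2 k0 k2 isT isT) (once i2 k1 k2 isT isT).
move: (once i3 k0 k1 isT isT) (once i3 k0 k2 isT isT) (once i3 k1 k2 isT isT).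
by do 6! case: (_ \in c @: _).
Qed.

Lemma three_triangles_not_1223 : ~ packing_colorable G [:: 1; 2; 2; 3].
Proof.
case/packing_mapP=> c c_pack.
have some k l (kl : k != l) :=
  linked_triangles_last_colour c_pack (triT k) (triT l) (linkT kl).
have once k l (kl : k != l) :=
  @far_colour_linked _ c c_pack _ _ ord_max
    (triT k).1 (triT l).1 (linkT kl) isT.
move: (some k0 k1 isT) (some k0 k2 isT) (some k1 k2 isT).
move: (once k0 k1 isT) (once k0 k2 isT) (once k1 k2 isT).
by do 3! case: (_ \in c @: _).
Qed.

End ThreeTriangles.

End Colouring.

(** * The triangles of A1 *)

(** Shifting the labels by one around the 9-cycle makes the triangles 912,
    345, 678 the three blocks of consecutive integers. *)
Definition A1_triangle (k : 'I_3) : {set A1} :=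
  [set i : 'I_9 | i.+1 %% 9 %/ 3 == k].

Lemma A1_triangleP k : triangle (A1_triangle k).
Proof.
split=> [x y|].
  rewrite !inE => /eqP xk /eqP; rewrite -{k}xk.
  case: x y => [i lt_i] [j lt_j] /=.
  by case: i lt_i => [|[|[|[|[|[|[|[|[|//]]]]]]]]] lt_i;
    case: j lt_j => [|[|[|[|[|[|[|[|[|//]]]]]]]]] lt_j.
have -> : #|A1_triangle k| = \sum_(i < 9) (i.+1 %% 9 %/ 3 == k).
  rewrite -sum1_card big_mkcond; apply: eq_bigr => i _.
  by rewrite inE; case: (_ == _).
by rewrite !big_ord_recl big_ord0; case: k => [[|[|[|]]]].
Qed.

Lemma A1_triangle_linked k l : k != l ->
  linked (A1_triangle k) (A1_triangle l).
Proof.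
wlog lkl : k l / l = k.+1 %% 3 :> nat => [next neq_kl | _].
  have [/next | k_l] : l = k.+1 %% 3 :> nat \/ k = l.+1 %% 3 :> nat.
    case: k l neq_kl {next} => [[|[|[|//]]] lt_k] [[|[|[|//]]] lt_l] //; auto.
    exact.
  by apply/linked_sym/next; rewrite 1?eq_sym.
(* In the shifted order the last vertex of block k precedes the first vertex of
   block k + 1; the ordinals of these two are 3k + 1 and 3k + 2. *)
split.
  rewrite disjoint_subset; apply/subsetP=> x; rewrite !inE lkl => /eqP->.
  by case: k {lkl} => [[|[|[|//]]]].
pose u : 'I_9 := inord (3 * k + 1); pose v : 'I_9 := inord (3 * k + 2).
have lt_u : 3 * k + 1 < 9 by case: k {lkl u v} => [[|[|[|//]]]].
have lt_v : 3 * k + 2 < 9 by case: k {lkl u v lt_u} => [[|[|[|//]]]].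
exists u, v; rewrite !inE /adj /= /A1_adj !inordK // lkl.
by case: k {lkl u v lt_u lt_v} => [[|[|[|//]]]].
Qed.

(** * A1 with a pendant path *)

Definition tailed_arc (i j : nat) : bool :=
  [|| (i.+1, j.+1) \in A1_edges, (i == 0) && (j == 9) | (8 < i) && (j == i.+1)].

(** The vertices 0, ..., 8 carry A1, whose labels are shifted by one, and
    9, 10, ... is a path hung at 0, that is at the vertex labelled 1. *)
Definition tailed_rel (i j : nat) : bool := tailed_arc i j || tailed_arc j i.

Lemma tailed_rel_sym : symmetric tailed_rel.
Proof. by move=> i j; rewrite /tailed_rel orbC. Qed.

Lemma tailed_rel_irrefl : irreflexive tailed_rel.
Proof.
move=> i; rewrite /tailed_rel orbb /tailed_arc (ltn_eqF (ltnSn i)) andbF orbF.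
by do 9! [case: i => [|i] //].
Qed.

Section Tailed.
Variable n : nat.

Definition tailed_adj : rel 'I_(9 + n) := fun i j => tailed_rel i j.

Lemma tailed_sym : symmetric tailed_adj.
Proof. by move=> x y; apply: tailed_rel_sym. Qed.

Lemma tailed_irrefl : irreflexive tailed_adj.
Proof. by move=> x; apply: tailed_rel_irrefl. Qed.

Definition tailed : sgraph := SGraph tailed_sym tailed_irrefl.

End Tailed.

Lemma tailed_arcP i j : tailed_arc i j ->
  [\/ i < 9 /\ j < 9, i = 0 /\ j = 9 | 8 < i /\ j = i.+1].
Proof.
pose label_le9 e := (e.1 <= 9) && (e.2 <= 9).
case/or3P=> [|/andP[/eqP-> /eqP->]|/andP[gt_i8 /eqP->]].
- move/(allP (isT : all label_le9 A1_edges))/andP=> [lt_i lt_j].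
  by constructor 1.
- by constructor 2.
- by constructor 3.
Qed.

(** The neighbours in the graph with an infinite tail, as an explicit list: the
    local properties of the graphs below only depend on it, and for i < 9 they
    can be computed. *)
Definition tailed_nbrs (i : nat) : seq nat :=
  if i < 9 then [seq j <- iota 0 10 | tailed_rel i j]
  else [:: if i == 9 then 0 else i.-1; i.+1].

Lemma tailed_nbrsP i j : tailed_rel i j -> j \in tailed_nbrs i.
Proof.
rewrite /tailed_nbrs => ij; case: ltnP => [lt_i9 | le_9i].
  rewrite mem_filter ij mem_iota /=.
  case/orP: ij => /tailed_arcP[[lt_9 lt_9'] | [def_i def_j] | [gt_8 def_j]].
  - exact: ltnW.
  - by rewrite def_j.
  - by rewrite ltnNge gt_8 in lt_i9.
  - exact: ltnW.
  - by rewrite def_j in lt_i9.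
  - by rewrite ltnW // ltnW // -def_j.
rewrite !inE.
case/orP: ij => /tailed_arcP[[lt_9 lt_9'] | [i0 j9] | [gt_8 def_j]].
- by rewrite ltnNge le_9i in lt_9.
- by rewrite i0 in le_9i.
- by rewrite def_j eqxx orbT.
- by rewrite ltnNge le_9i in lt_9'.
- by rewrite i0 j9.
- by rewrite def_j eqSS (gtn_eqF gt_8) eqxx.
Qed.

Lemma tailed_nbrs_size i : size (tailed_nbrs i) <= 3.
Proof.
rewrite /tailed_nbrs; case: ltnP => // lt_i9.
by move: i lt_i9; do 9! [case=> [|i] //; move: i].
Qed.

(** No vertex is the centre of a claw: a vertex of the path has at most two
    neighbours, and those of A1 are checked one by one. *)
Lemma tailed_nbrs_adj i j k l :
    j \in tailed_nbrs i -> k \in tailed_nbrs i -> l \in tailed_nbrs i ->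
    uniq [:: j; k; l] ->
  [|| tailed_rel j k, tailed_rel j l | tailed_rel k l].
Proof.
rewrite /tailed_nbrs; case: ltnP => [lt_i9 | _] ij ik il Ujkl; last first.
  suff: size [:: j; k; l] <= 2 by [].
  have -> : 2 = size [:: if i == 9 then 0 else i.-1; i.+1] by [].
  by apply: uniq_leq_size => // m; rewrite !inE => /or3P[] /eqP->;
    move: ij ik il; rewrite !inE.
pose clawless i :=
  let s := [seq j <- iota 0 10 | tailed_rel i j] in
  all (fun j => all (fun k => all (fun l => uniq [:: j; k; l] ==>
    [|| tailed_rel j k, tailed_rel j l | tailed_rel k l]) s) s) s.
have: all clawless (iota 0 9) by vm_compute.
move/allP/(_ i); rewrite mem_iota => /(_ lt_i9).
by move=> /allP/(_ j ij)/allP/(_ k ik)/allP/(_ l il)/implyP; apply.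
Qed.

Lemma tailed_rel_succ i : i != 8 -> tailed_rel i i.+1.
Proof.
rewrite /tailed_rel /tailed_arc eqxx andbT.
by do 9! [case: i => [|i] //].
Qed.

Lemma tailed_connected n : connected (tailed n).
Proof.
pose z : tailed n := @Ordinal (9 + n) 0 isT.
have sym : connect_sym (@adj (tailed n)) by apply/sym_connect_sym/adj_sym.
suff from_z x : connect (@adj (tailed n)) z x.
  split=> [|x y]; first by apply/card_gt0P; exists z.
  by apply: connect_trans (from_z y); rewrite sym.
case: x; elim=> [|i IHi] lt_i.
  by rewrite (_ : Ordinal lt_i = z) //; apply: val_inj.
(* The path starts at 0, not at 8, so 9 is the only positive vertex that is
   not joined to its predecessor. *)
have [i8 | i'8] := eqVneq i 8.
  by apply: connect1; rewrite /adj /= /tailed_adj /= i8.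
apply: connect_trans (IHi (ltnW lt_i)) _.
exact/connect1/tailed_rel_succ.
Qed.

Lemma tailed_subcubic n : subcubic (tailed n).
Proof.
apply/bigmax_leqP=> x _; apply: leq_trans (tailed_nbrs_size x).
rewrite /degree cardE -(size_map val); apply: uniq_leq_size.
  by rewrite (map_inj_uniq val_inj) enum_uniq.
by move=> _ /mapP[y + ->]; rewrite mem_enum inE => /tailed_nbrsP.
Qed.

Lemma tailed_claw_free n : claw_free (tailed n).
Proof.
case=> f f_inj f_adj.
pose leaf m (lt_m : m < 4) := f (Ordinal lt_m).
pose y1 := @leaf 1 isT; pose y2 := @leaf 2 isT; pose y3 := @leaf 3 isT.
have nbr m (lt_m : m.+1 < 4) : val (leaf _ lt_m) \in tailed_nbrs (f ord0).
  have: adj (f ord0) (leaf _ lt_m) by rewrite f_adj.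
  exact: tailed_nbrsP.
have uniq_y : uniq [:: val y1; val y2; val y3].
  by rewrite (map_inj_uniq val_inj [:: y1; y2; y3])
             (map_inj_uniq f_inj [:: _; _; _]).
have: [|| adj y1 y2, adj y1 y3 | adj y2 y3].
  exact: tailed_nbrs_adj (nbr 0 isT) (nbr 1 isT) (nbr 2 isT) uniq_y.
by rewrite !f_adj.
Qed.

Lemma tailed_contains_A1 n : contains_subgraph (tailed n) A1.
Proof.
exists (lshift n) => [|x y]; first exact: lshift_inj.
rewrite /adj /= /A1_adj /tailed_adj /tailed_rel /tailed_arc /=.
by case/orP=> ->; rewrite ?orbT.
Qed.

Lemma tailed_not_isomorphic m n : m <> n -> ~ isomorphic (tailed m) (tailed n).
Proof.
move=> neq_mn [f f_bij _]; apply: neq_mn.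
have /eqP := bij_eq_card f_bij.
by rewrite !card_ord eqn_add2l => /eqP.
Qed.

Theorem proposition2 :
  [/\ ~ packing_colorable A1 [:: 1; 1; 3; 3],
      ~ packing_colorable A1 [:: 1; 2; 2; 3]
    & exists G : nat -> sgraph,
        (forall n, [/\ connected (G n), claw_free (G n), subcubic (G n)
                     & contains_subgraph (G n) A1])
        /\ (forall m n, m <> n -> ~ isomorphic (G m) (G n))].
Proof.
split.
- exact: three_triangles_not_1133 A1_triangleP A1_triangle_linked.
- exact: three_triangles_not_1223 A1_triangleP A1_triangle_linked.
- exists tailed; split=> [n|]; last exact: tailed_not_isomorphic.
  split; [exact: tailed_connected | exact: tailed_claw_free
        | exact: tailed_subcubic | exact: tailed_contains_A1].
Qed.
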